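(* Let $m,n$ be two positive integers and let $\lambda,\mu$ be two (positive) partitions with $\lambda\supset\mu$. Then $$ \mathbb{F}_{\lambda/\mu}(x_1,\dots,x_{m+n})=\sum_{\nu}\mathbb{F}_{\nu/\mu}(x_1,\dots,x_m)\,\mathbb{F}_{\lambda/\nu}(x_{m+1},\dots,x_{m+n}), $$ $$ \mathbb{F}^{*}_{\lambda/\mu}(x_1,\dots,x_{m+n})=\sum_{\nu}\mathbb{F}^{*}_{\nu/\mu}(x_1,\dots,x_m)\,\mathbb{F}^{*}_{\lambda/\nu}(x_{m+1},\dots,x_{m+n}), $$ where both summations are over all partitions $\nu$ such that $\lambda\supset\nu\supset\mu$.
   Context: Fix $q,s\in\mathbb{C}$ with $|q|<1$, $|s|<1$. Write $(a;q)_m=\prod_{i=1}^m(1-aq^{i-1})$ for $m\ge 1$, $(a;q)_0=1$, $(a;q)_\infty=\prod_{i\ge1}(1-aq^{i-1})$. A (positive) partition is a finite, possibly empty, sequence $\lambda_1\ge\dots\ge\lambda_\ell\ge1$ of integers; $\ell(\lambda)=\ell$; $\lambda_i:=0$ for $i>\ell(\lambda)$. $\lambda\supset\mu$ means $\ell(\lambda)\ge\ell(\mu)$ and $\lambda_i\ge\mu_i$ for all $1\le i\le\ell(\mu)$. Vertex weights: for $x\in\mathbb{C}$ and $i,j,k,\ell\in\mathbb{Z}_{\ge0}$, $$W_x(i,j;k,\ell)=\mathbf 1_{i+j=k+\ell}\,\mathbf 1_{i\ge\ell}\;x^\ell\frac{(-s/x;q)_\ell\,(-sx;q)_{i-\ell}\,(q;q)_k}{(q;q)_\ell\,(q;q)_{i-\ell}\,(s^2;q)_k},$$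 where $x^\ell(-s/x;q)_\ell$ is read as the polynomial $\prod_{r=0}^{\ell-1}(x+sq^r)$. ($i,j,k,\ell$ are the numbers of paths on the bottom, left, top, right edges of the vertex.) Skew spin $q$-Whittaker polynomial: for partitions $\lambda,\mu$, $$\mathbb{F}_{\lambda/\mu}(x_1,\dots,x_n)=\sum\prod_{r=1}^n\left[x_r^{h_{r,0}}\frac{(-s/x_r;q)_{h_{r,0}}}{(q;q)_{h_{r,0}}}\prod_{c\ge1}W_{x_r}\big(v_{r-1,c},h_{r,c-1};v_{r,c},h_{r,c}\big)\right],$$ the sum running over all non-negative integers $h_{r,c}$ ($1\le r\le n$, $c\ge0$), with $h_{r,c}=0$ for all large $c$, and $v_{r,c}$ ($0\le r\le n$, $c\ge1$) subject to $v_{0,c}=\mu_c-\mu_{c+1}$ and $v_{n,c}=\lambda_c-\lambda_{c+1}$; all but finitely many vertex weights equal $W_x(0,0;0,0)=1$ in any nonzero term. (Equivalently: the partition function on columns $0,1,2,\dots$ and rows $1,\dots,n$ numbered from bottom to top, row $r$ carrying $x_r$, all left and right boundary edges empty, infinitely many paths in column $0$ with weights $W_x(\infty,0;\infty,\ell)=x^\ell\frac{(-s/x;q)_\ell(-sx;q)_\infty}{(q;q)_\ell(s^2;q)_\infty}$, divided by $\prod_{i=1}^n(-sx_i;q)_\infty/(s^2;q)_\infty$.) Dual polynomials: $$\mathbb{F}^*_{\lambda/\mu}(x_1,\dots,x_n)=\frac{\tilde c_{\lambda'}}{\tilde c_{\mu'}}\,\mathbb{F}_{\lambda/\mu}(x_1,\dots,x_n),\qquad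 \tilde c_{\lambda'}=\prod_{i\ge1}\frac{(s^2;q)_{\lambda_i-\lambda_{i+1}}}{(q;q)_{\lambda_i-\lambda_{i+1}}}.$$ *)

(* Defs.v *)
From HB Require Import structures.
From mathcomp Require Import all_boot all_order all_algebra.
From mathcomp Require Import boolp classical_sets functions cardinality fsbigop.
Set Implicit Arguments.
Unset Strict Implicit.
Unset Printing Implicit Defensive.
Import GRing.Theory.
Local Open Scope classical_set_scope.
Local Open Scope ring_scope.

Definition is_part (lam : seq nat) : bool :=
  sorted geq lam && all (leq 1) lam.

(* [part_incl mu lam] is the relation lam ⊃ mu. *)
Definition part_incl (mu lam : seq nat) : Prop :=
  (size mu <= size lam)%N /\
  forall i, (i < size mu)%N -> (nth 0 mu i <= nth 0 lam i)%N.

(* Zero-based: [mult_diff lam c] is lambda_{c+1} - lambda_{c+2}, where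
   lambda_i = 0 beyond the length. *)
Definition mult_diff (lam : seq nat) (c : nat) : nat :=
  (nth 0 lam c - nth 0 lam c.+1)%N.

Section SpinqWhittaker.
Variables (K : fieldType) (q s : K).

Definition qpoch (a : K) (m : nat) : K := \prod_(i < m) (1 - a * q ^+ i).

(* x^l (-s/x; q)_l, read as a polynomial in x. *)
Definition xqpoch (x : K) (l : nat) : K := \prod_(r < l) (x + s * q ^+ r).

(* i, j, k, l: numbers of paths on the bottom, left, top, right edges. *)
Definition vweight (x : K) (i j k l : nat) : K :=
  if (i + j == k + l)%N && (l <= i)%N then
    (xqpoch x l * qpoch (- s * x) (i - l) * qpoch q k) /
    (qpoch q l * qpoch q (i - l) * qpoch (s ^+ 2) k)
  else 0.

Section Skew.
Variables (n : nat) (lam mu : seq nat) (x : 'I_n -> K).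

(* A configuration is a pair (h, v) in which
     [h r c] is h_{r+1,c} for r < n and c >= 0 (rows are zero-based),
     [v r c] is v_{r,c+1} for r <= n and c >= 0 (no vertical label is attached
             to column 0).
   The v_{r,c} with 0 < r < n are also taken to vanish for all large c: as
   v_{0,c} and h_{r,c} do, any other choice violates path conservation at some
   vertex, so its term is zero. Hence every product over columns below has
   finitely many factors different from 1. *)
Definition configs : set (('I_n -> nat -> nat) * ('I_n.+1 -> nat -> nat)) :=
  [set hv | [/\ exists N, forall r c, (N <= c)%N -> hv.1 r c = 0%N,
                exists N, forall r c, (N <= c)%N -> hv.2 r c = 0%N,
                forall c, hv.2 ord0 c = mult_diff mu c &
                forall c, hv.2 ord_max c = mult_diff lam c]].

(* [widen_ord (leqnSn n) r] and [lift ord0 r] have values r and r + 1: the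
   levels just below and just above row r. *)
Definition config_weight
    (hv : ('I_n -> nat -> nat) * ('I_n.+1 -> nat -> nat)) : K :=
  \prod_(r < n)
    (xqpoch (x r) (hv.1 r 0%N) / qpoch q (hv.1 r 0%N) *
     \big[*%R/1]_(c \in [set: nat])
        vweight (x r) (hv.2 (widen_ord (leqnSn n) r) c) (hv.1 r c)
                      (hv.2 (lift ord0 r) c) (hv.1 r c.+1)).

(* Finitely many terms are nonzero: conservation makes
   \sum_c v_{r,c} = \sum_c v_{r-1,c} + h_{r,0}, and h_{r,c} <= v_{r-1,c} for
   c >= 1, so all labels and the number of occupied columns are bounded. *)
Definition skewF : K := \sum_(hv \in configs) config_weight hv.

End Skew.

(* The constant \tilde c_{lambda'} (indexed by the conjugate of [lam]); the
   factors beyond the length of [lam] equal 1. *)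
Definition ctilde_conj (lam : seq nat) : K :=
  \prod_(i < size lam)
    (qpoch (s ^+ 2) (mult_diff lam i) / qpoch q (mult_diff lam i)).

Definition skewFdual (n : nat) (lam mu : seq nat) (x : 'I_n -> K) : K :=
  ctilde_conj lam / ctilde_conj mu * skewF lam mu x.

End SpinqWhittaker.

(* Main.v *)
(* In a configuration of nonzero weight, path conservation makes the tail sums
   of the vertical labels nondecreasing from one level to the next, starting at
   the parts of mu and ending at the parts of lambda.  Hence all labels are
   bounded by the parts of lambda, so that the sums are finite, and the labels
   of level m are the multiplicities of a unique partition nu with
   mu ⊂ nu ⊂ lambda.  Cutting along level m turns the configurations with a
   given nu into pairs of configurations, and weights multiply. *)
Require Import Defs.
From mathcomp Require Import all_boot all_order all_algebra.
From mathcomp Require Import boolp classical_sets functions cardinality fsbigop.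
From mathcomp Require Import reals.
From mathcomp.real_closed Require Import complex.
Import GRing.Theory Num.Theory.
Local Open Scope classical_set_scope.
Local Open Scope ring_scope.

(** * Partitions, their multiplicities and their tail sums *)

Lemma is_part_nth_geq (lam : seq nat) (i : nat) :
  is_part lam -> (nth 0 lam i.+1 <= nth 0 lam i)%N.
Proof.
move=> /andP[slam _]; case: (ltnP i.+1 (size lam)) => hi; last by rewrite nth_default.
by move: slam => /(sortedP 0%N) /(_ i hi).
Qed.

Lemma is_part_nth_gt0 (lam : seq nat) (i : nat) :
  is_part lam -> (0 < nth 0 lam i)%N = (i < size lam)%N.
Proof.
move=> /andP[_ /(all_nthP 0%N) plam].
case: (ltnP i (size lam)) => hi; first exact: plam.
by rewrite nth_default.
Qed.

(** With zero padding the length condition becomes automatic: the last part of [mu] is positive, so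
    [lam] has a positive entry at that index too. *)
Lemma part_inclP (mu lam : seq nat) : is_part mu -> is_part lam ->
  part_incl mu lam <-> forall i, (nth 0 mu i <= nth 0 lam i)%N.
Proof.
move=> pmu plam; split=> [[_ le_ml] i|le_ml].
  by case: (ltnP i (size mu)) => [/le_ml//|hi]; rewrite nth_default.
split=> [|i _]; last exact: le_ml.
case sz: (size mu) => [//|k]; rewrite -(is_part_nth_gt0 _ _ plam).
by apply: leq_trans (le_ml k); rewrite is_part_nth_gt0 ?sz.
Qed.

Lemma sum_mult_diff (lam : seq nat) (a N : nat) :
  is_part lam -> (size lam <= N)%N ->
  (\sum_(a <= c < N) mult_diff lam c = nth 0 lam a)%N.
Proof.
move=> plam szN; case: (leqP N a) => [leNa|/ltnW leaN].
  by rewrite big_geq // nth_default // (leq_trans szN).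
(* Restoring the zero term at [N] gives a telescoping identity that no longer needs [size lam <= N],
   so induction on [N] applies. *)
have -> : nth 0%N lam a = (nth 0 lam a - nth 0 lam N)%N.
  by rewrite (nth_default _ szN) subn0.
elim: N leaN {szN} => [|N IHN].
  by rewrite leqn0 => /eqP->; rewrite big_geq ?subnn.
rewrite leq_eqVlt => /predU1P[->|]; first by rewrite big_geq ?subnn.
rewrite ltnS => leaN; rewrite big_nat_recr //= IHN // /mult_diff.
rewrite addnBA ?is_part_nth_geq // subnK //.
elim: N leaN {IHN} => [|N IHN]; first by rewrite leqn0 => /eqP->.
rewrite leq_eqVlt => /predU1P[->//|]; rewrite ltnS => /IHN.
exact/leq_trans/is_part_nth_geq.
Qed.

Lemma mult_diff_inj (lam mu : seq nat) : is_part lam -> is_part mu ->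
  mult_diff lam =1 mult_diff mu -> lam = mu.
Proof.
move=> plam pmu e.
have en i : nth 0%N lam i = nth 0%N mu i.
  rewrite -(@sum_mult_diff lam i (maxn (size lam) (size mu))) ?leq_maxl //.
  rewrite -(@sum_mult_diff mu i (maxn (size lam) (size mu))) ?leq_maxr //.
  exact: eq_bigr.
apply: (@eq_from_nth _ 0%N) => //.
apply/eqP; rewrite eqn_leq leqNgt -is_part_nth_gt0 // en is_part_nth_gt0 //.
by rewrite ltnn leqNgt -is_part_nth_gt0 // -en is_part_nth_gt0 // ltnn.
Qed.

(** Induction on [N] through the shifted sequence. If [t 0] is zero then [t] vanishes identically
    and only the empty partition fits, as parts are positive. *)
Lemma part_of_nonincreasing (t : nat -> nat) (N : nat) :
  (forall i, (t i.+1 <= t i)%N) -> t N = 0%N ->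
  exists2 nu, is_part nu & nth 0%N nu =1 t.
Proof.
elim: N t => [|N IHN] t tS tN.
  exists [::] => // i; rewrite nth_nil; elim: i => // i IHi.
  by apply/esym/eqP; rewrite -leqn0 IHi tS.
have [//|nu /andP[snu pnu] enu] := IHN (t \o S) (fun i => tS i.+1).
case: (posnP (t 0%N)) => [t0|t0].
  exists [::] => // i; rewrite nth_nil; elim: i => // i IHi.
  by apply/esym/eqP; rewrite -leqn0 IHi tS.
exists (t 0%N :: nu) => [|[|i]//]; last by rewrite /= enu.
rewrite /is_part /= pnu t0 andbT.
case: nu enu snu {pnu} => //= a nu /(_ 0%N)/= -> ->.
by rewrite tS.
Qed.

(** * Finiteness of bounded families of labels and partitions *)

Lemma finite_bounded_funs (I : finType) (b : nat -> nat) (N : nat) :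
  (forall c, (N <= c)%N -> b c = 0%N) ->
  finite_set [set f : I -> nat -> nat | forall i c, (f i c <= b c)%N].
Proof.
move=> bN; pose B := (\max_(c < N) b c)%N.
pose ext (g : {ffun I * 'I_N -> 'I_B.+1}) (i : I) (c : nat) : nat :=
  if insub c is Some c' then g (i, c') else 0%N.
apply: (@sub_finite_set _ _ (range ext)); last exact/finite_image/finite_finset.
move=> f fb; exists [ffun p : I * 'I_N => inord (f p.1 p.2)] => //.
apply/funext => i; apply/funext => c; rewrite /ext.
case: insubP => [c' _ <-|].
  rewrite ffunE inordK // ltnS (leq_trans (fb _ _)) //.
  exact: (leq_bigmax c').
by rewrite -leqNgt => /bN bc; apply/esym/eqP; rewrite -leqn0 -bc.
Qed.

(** The sequences here may end in zeros, so each is recovered from its padded entry function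
    together with its length. *)
Lemma finite_parts_in (lam : seq nat) :
  finite_set [set nu : seq nat | part_incl nu lam].
Proof.
pose A := [set f : unit -> nat -> nat | forall i c, (f i c <= nth 0 lam c)%N].
apply: (@sub_finite_set _ _
  [set mkseq (f tt) k | f in A & k in `I_(size lam).+1]).
  move=> nu [snu le_nu]; exists (fun=> nth 0%N nu).
    by move=> _ c; case: (ltnP c (size nu)) => [/le_nu//|/(nth_default 0%N)->].
  by exists (size nu); rewrite /= ?ltnS // mkseq_nth.
apply: finite_image2; last exact: finite_II.
by apply: (@finite_bounded_funs _ _ (size lam)) => c; exact: nth_default.
Qed.

Lemma inord_widen (n : nat) (r : 'I_n) : widen_ord (leqnSn n) r = inord r.
Proof. by apply/val_inj; rewrite /= inordK // ltnS ltnW. Qed.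

Lemma inord_lift0 (n : nat) (r : 'I_n) : lift ord0 r = inord r.+1.
Proof. by apply/val_inj; rewrite /= inordK // ltnS. Qed.

(** * Configurations of nonzero weight *)

Section Support.
Variables (K : fieldType) (q s : K).

Lemma vweight0 (x : K) : vweight q s x 0 0 0 0 = 1.
Proof. by rewrite /vweight /= /xqpoch /qpoch !big_ord0 !mulr1 divr1. Qed.

Lemma vweight_neq0 (x : K) (i j k l : nat) :
  vweight q s x i j k l != 0 -> (i + j)%N = (k + l)%N.
Proof. by rewrite /vweight; case: (@eqP nat) => //=; rewrite eqxx. Qed.

Variables (n : nat) (lam mu : seq nat) (x : 'I_n -> K).
Hypotheses (plam : is_part lam) (pmu : is_part mu).

(** The finitely supported sum defining [skewF] runs over this set, and would be 0 by convention if
    the set were infinite; hence the finiteness proof below. *)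
Definition support_configs :
    set (('I_n -> nat -> nat) * ('I_n.+1 -> nat -> nat)) :=
  configs lam mu `&` config_weight q s x @^-1` [set~ 0].

Lemma config_conservation hv : support_configs hv ->
  forall (r : 'I_n) c, (hv.2 (inord r) c + hv.1 r c)%N =
                       (hv.2 (inord r.+1) c + hv.1 r c.+1)%N.
Proof.
move=> [[[N1 h0] [N2 v0] _ _] /eqP]; rewrite /config_weight.
move=> /prodf_neq0 + r c => /(_ r isT); rewrite mulf_eq0 negb_or => /andP[_].
rewrite inord_widen inord_lift0; set N := maxn N1 N2.
have vac d : (N <= d)%N ->
    vweight q s (x r) (hv.2 (inord r) d) (hv.1 r d)
      (hv.2 (inord r.+1) d) (hv.1 r d.+1) = 1.
  rewrite geq_max => /andP[N1d N2d]; rewrite !v0 // !h0 ?vweight0 //.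
  exact: leqW.
(* Columns from [N] on contribute 1, so the product becomes a finite one, each of whose factors must
   be nonzero. *)
rewrite (fsbigE (iota 0 N)) ?iota_uniq //; last first.
  by move=> d _; rewrite mem_iota /= add0n -leqNgt => /vac.
rewrite prodf_seq_neq0 => /allP nz; case: (leqP N c) => Nc.
  move: Nc; rewrite geq_max => /andP[N1c N2c].
  by rewrite !v0 // !h0 //; exact: leqW.
have /nz : c \in iota 0 N by rewrite mem_iota.
by rewrite in_setT => /vweight_neq0.
Qed.

Lemma config_vanish hv : support_configs hv ->
  exists2 N, (size lam <= N)%N && (size mu <= N)%N &
    (forall r c, (N <= c)%N -> hv.1 r c = 0%N) /\
    (forall r c, (N <= c)%N -> hv.2 r c = 0%N).
Proof.
move=> [[[N1 h0] [N2 v0] _ _] _].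
exists (maxn (maxn (size lam) (size mu)) (maxn N1 N2)).
  by rewrite !leq_max !leqnn ?orbT.
split=> r c; rewrite !geq_max => /andP[_ /andP[? ?]]; first exact: h0.
exact: v0.
Qed.

(** Summing conservation over the columns from [a] on cancels every horizontal label except the one
    entering column [a]. *)
Lemma config_tail_row hv N (r : 'I_n) a : support_configs hv ->
  (forall r c, (N <= c)%N -> hv.1 r c = 0%N) ->
  (forall r c, (N <= c)%N -> hv.2 r c = 0%N) ->
  (\sum_(a <= c < N) hv.2 (inord r) c + hv.1 r a =
   \sum_(a <= c < N) hv.2 (inord r.+1) c)%N.
Proof.
move=> Shv h0 v0; case: (leqP N a) => [leNa|/ltnW leaN].
  by rewrite !big_geq // h0.
(* Adding the outgoing horizontal labels to both sides avoids truncated subtraction. *)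
apply/(@addnI (\sum_(a <= c < N) hv.1 r c.+1)%N).
rewrite [RHS]addnC -big_split /=.
under [RHS]eq_bigr do rewrite -config_conservation //.
rewrite big_split /= addnCA; congr addn.
by rewrite addnC -big_nat_recl // big_nat_recr //= (h0 _ N) ?addn0.
Qed.

(** Tail sums grow with the level by [config_tail_row], and at levels 0 and [n] they telescope to
    the parts of [mu] and [lam]. *)
Lemma config_tail_bounds hv N k a : support_configs hv ->
  (size lam <= N)%N -> (size mu <= N)%N ->
  (forall r c, (N <= c)%N -> hv.1 r c = 0%N) ->
  (forall r c, (N <= c)%N -> hv.2 r c = 0%N) -> (k <= n)%N ->
  (nth 0 mu a <= \sum_(a <= c < N) hv.2 (inord k) c <= nth 0 lam a)%N.
Proof.
move=> Shv szl szm h0 v0 lekn.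
have mono i j : (i <= j <= n)%N -> (\sum_(a <= c < N) hv.2 (inord i) c <=
                           \sum_(a <= c < N) hv.2 (inord j) c)%N.
  elim: j => [|j IHj]; first by rewrite leqn0 => /andP[/eqP->].
  move=> /andP[+ ltjn]; rewrite leq_eqVlt => /predU1P[->//|leij].
  apply: leq_trans (IHj _) _; first by rewrite -ltnS leij ltnW.
  by rewrite -(config_tail_row _ _ (Ordinal ltjn) _ Shv) //= leq_addr.
have [[_ _ vmu vlam] _] := Shv.
apply/andP; split.
  rewrite -(sum_mult_diff mu a N) //.
  have -> : mult_diff mu = hv.2 (inord 0).
    apply/funext => c; rewrite -vmu; congr (hv.2 _ c).
    by apply/val_inj; rewrite /= inordK.
  by apply: mono; rewrite lekn.
rewrite -(sum_mult_diff lam a N) //.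
have -> : mult_diff lam = hv.2 (inord n).
  apply/funext => c; rewrite -vlam; congr (hv.2 _ c).
  by apply/val_inj; rewrite /= inordK.
by apply: mono; rewrite lekn leqnn.
Qed.

Lemma finite_support_configs : finite_set support_configs.
Proof.
pose A (I : finType) :=
  [set f : I -> nat -> nat | forall i c, (f i c <= nth 0 lam c)%N].
have fA I : finite_set (A I).
  by apply: (@finite_bounded_funs _ _ (size lam)) => c; exact: nth_default.
apply: sub_finite_set (finite_setX (fA 'I_n) (fA 'I_n.+1)) => hv Shv.
have [N /andP[szl szm] [h0 v0]] := config_vanish _ Shv; split=> r c.
  (* The label [hv.1 r c] is one summand of the tail sum at level [r.+1], so it inherits the bound
     of that level. *)
  have := config_tail_bounds _ _ r.+1 c Shv szl szm h0 v0 (ltn_ord r).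
  rewrite -(config_tail_row _ _ r c Shv) // => /andP[_]; apply: leq_trans.
  exact: leq_addl.
have lern : (r <= n)%N by rewrite -ltnS.
have /andP[_] := config_tail_bounds _ _ r c Shv szl szm h0 v0 lern.
rewrite inord_val; case: (leqP N c) => [/v0->//|ltcN]; apply: leq_trans.
by rewrite big_ltn // leq_addr.
Qed.

Lemma config_level_part hv k : support_configs hv -> (k <= n)%N ->
  exists nu, [/\ is_part nu, part_incl nu lam, part_incl mu nu &
                 hv.2 (inord k) = mult_diff nu].
Proof.
move=> Shv lekn; have [N /andP[szl szm] [h0 v0]] := config_vanish _ Shv.
(* The tail sums of level [k] are the parts of the required partition; their successive differences
   return the labels. *)
pose t a := (\sum_(a <= c < N) hv.2 (inord k) c)%N.
have tE a : t a = (hv.2 (inord k) a + t a.+1)%N.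
  rewrite /t; case: (ltnP a N) => [ltaN|leNa]; first by rewrite big_ltn.
  by rewrite v0 // !big_geq // ltnW.
have [||nu pnu enu] := part_of_nonincreasing t N.
- by move=> a; rewrite [leqRHS]tE leq_addl.
- by rewrite /t big_geq.
have bnd a := config_tail_bounds _ _ k a Shv szl szm h0 v0 lekn.
exists nu; split=> //.
- by apply/part_inclP => // i; rewrite enu; have /andP[] := bnd i.
- by apply/part_inclP => // i; rewrite enu; have /andP[] := bnd i.
- by apply/funext => c; rewrite /mult_diff !enu tE addnK.
Qed.

Lemma skewF_support :
  skewF q s lam mu x = \sum_(hv \in support_configs) config_weight q s x hv.
Proof. exact: fsbig_supp. Qed.

End Support.
Arguments support_configs {K} q s {n} lam mu x _.

(** * Cutting and gluing along level [m] *)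

Section Glue.
Variables (m n : nat).

Definition glue_rows {T} (f : 'I_m -> T) (g : 'I_n -> T) (i : 'I_(m + n)) : T :=
  match fintype.split i with inl a => f a | inr b => g b end.

(* The common level m is read off [g]; the lemmas below assume that the top
   level of [f] agrees with the bottom level of [g]. *)
Definition glue_levels {T} (f : 'I_m.+1 -> T) (g : 'I_n.+1 -> T)
    (i : 'I_(m + n).+1) : T :=
  if (i < m)%N then f (inord i) else g (inord (i - m)).

Lemma glue_rowsL {T} (f : 'I_m -> T) (g : 'I_n -> T) i :
  glue_rows f g (lshift n i) = f i.
Proof. by rewrite /glue_rows -[lshift n i]/(unsplit (inl i)) unsplitK. Qed.

Lemma glue_rowsR {T} (f : 'I_m -> T) (g : 'I_n -> T) i :
  glue_rows f g (rshift m i) = g i.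
Proof. by rewrite /glue_rows -[rshift m i]/(unsplit (inr i)) unsplitK. Qed.

Lemma glue_levelsL {T} (f : 'I_m.+1 -> T) (g : 'I_n.+1 -> T) i :
  f ord_max = g ord0 -> (i <= m)%N ->
  glue_levels f g (inord i) = f (inord i).
Proof.
move=> fg leim; rewrite /glue_levels inordK; last first.
  by rewrite ltnS (leq_trans leim) ?leq_addr.
(* Only [i = m] needs the compatibility hypothesis, since there the value is read off level 0 of
   [g]. *)
move: leim; rewrite leq_eqVlt => /predU1P[->|->//]; rewrite ltnn subnn.
rewrite (_ : inord 0 = ord0); last by apply/val_inj; rewrite /= inordK.
by rewrite (_ : inord m = ord_max) //; apply/val_inj; rewrite /= inordK.
Qed.

Lemma glue_levelsR {T} (f : 'I_m.+1 -> T) (g : 'I_n.+1 -> T) i :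
  (i <= n)%N -> glue_levels f g (inord (m + i)) = g (inord i).
Proof.
move=> lein; rewrite /glue_levels inordK; last by rewrite ltnS leq_add2l.
by rewrite ltnNge leq_addr /= addKn.
Qed.

Definition glue_configs
    (p : (('I_m -> nat -> nat) * ('I_m.+1 -> nat -> nat)) *
         (('I_n -> nat -> nat) * ('I_n.+1 -> nat -> nat))) :
    ('I_(m + n) -> nat -> nat) * ('I_(m + n).+1 -> nat -> nat) :=
  (glue_rows p.1.1 p.2.1, glue_levels p.1.2 p.2.2).

Variables (K : fieldType) (q s : K) (x : 'I_(m + n) -> K).
Let x1 (i : 'I_m) := x (lshift n i).
Let x2 (j : 'I_n) := x (rshift m j).

Lemma config_weight_glue p : p.1.2 ord_max = p.2.2 ord0 ->
  config_weight q s x (glue_configs p) =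
  config_weight q s x1 p.1 * config_weight q s x2 p.2.
Proof.
move=> e; rewrite /config_weight big_split_ord /=; congr (_ * _).
  apply: eq_bigr => r _; rewrite !glue_rowsL !inord_widen !inord_lift0 /=.
  by rewrite !glue_levelsL // ltnW.
apply: eq_bigr => r _; rewrite !glue_rowsR !inord_widen !inord_lift0 /=.
by rewrite -addnS !glue_levelsR // ltnW.
Qed.

Variables (lam mu : seq nat).

(** Fixing level [m] to the multiplicities of [nu] supplies both the top boundary of the lower block
    and the bottom boundary of the upper one. Supports correspond because a product in a field is
    nonzero exactly when both factors are. *)
Lemma glue_configs_bij (nu : seq nat) :
  set_bij (support_configs q s nu mu x1 `*` support_configs q s lam nu x2)
    (support_configs q s lam mu x `&` [set hv | hv.2 (inord m) = mult_diff nu])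
    glue_configs.
Proof.
have i0 k : inord 0 = ord0 :> 'I_k.+1 by apply/val_inj; rewrite /= inordK.
have iM k : inord k = ord_max :> 'I_k.+1 by apply/val_inj; rewrite /= inordK.
have compat p : (support_configs q s nu mu x1 `*`
    support_configs q s lam nu x2) p -> p.1.2 ord_max = p.2.2 ord0.
  by move=> [[[_ _ _ e1] _] [[_ _ e2 _] _]]; apply/funext => c; rewrite e1 e2.
split.
- move=> p Sp; have e := compat _ Sp; case: Sp => -[C1 w1] [C2 w2].
  move: C1 C2 => [[N1 h1] [N1' v1] b1 t1] [[N2 h2] [N2' v2] b2 t2].
  split; last first.
    by rewrite /= glue_levelsL // iM; exact/funext.
  split; last by rewrite /preimage /= config_weight_glue //; apply/eqP;
                 rewrite mulf_neq0 //; exact/eqP.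
  split=> /=.
  + exists (maxn N1 N2) => r c; rewrite geq_max /glue_rows => /andP[? ?].
    by case: fintype.split => ?; [exact: h1|exact: h2].
  + exists (maxn N1' N2') => r c; rewrite geq_max /glue_levels => /andP[? ?].
    by case: ifP => _; [exact: v1|exact: v2].
  + by move=> c; rewrite -i0 glue_levelsL // i0.
  + by move=> c; rewrite -iM glue_levelsR // iM.
- move=> p p' /set_mem Sp /set_mem Sp'.
  have e := compat _ Sp; have e' := compat _ Sp'.
  case: p p' e e' {Sp Sp'} => [[h1 v1] [h2 v2]] [[h1' v1'] [h2' v2']] /= e e'.
  move=> [eh ev]; congr ((_, _), (_, _)); apply/funext => i.
  + by rewrite -(glue_rowsL h1 h2) eh glue_rowsL.
  + have lei : (i <= m)%N by rewrite -ltnS.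
    by rewrite -(inord_val i) -(glue_levelsL v1 v2) // ev glue_levelsL.
  + by rewrite -(glue_rowsR h1 h2) eh glue_rowsR.
  + have lei : (i <= n)%N by rewrite -ltnS.
    by rewrite -(inord_val i) -(glue_levelsR v1 v2) // ev glue_levelsR.
- move=> [h v] [[/= C w] em].
  (* The preimage is obtained by restriction, with level [m] copied into both blocks. *)
  pose p : (('I_m -> nat -> nat) * ('I_m.+1 -> nat -> nat)) *
           (('I_n -> nat -> nat) * ('I_n.+1 -> nat -> nat)) :=
    ((fun i => h (lshift n i), fun i : 'I_m.+1 => v (inord i)),
     (fun j => h (rshift m j), fun j : 'I_n.+1 => v (inord (m + j)))).
  have e : p.1.2 ord_max = p.2.2 ord0 by rewrite /= addn0.
  have pE : glue_configs p = (h, v).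
    congr (_, _); apply/funext => i.
      by rewrite /= /glue_rows -[in RHS](splitK i); case: fintype.split.
    rewrite /= -(inord_val i); case: (leqP i m) => [leim|/ltnW lemi].
      by rewrite glue_levelsL //= inordK.
    have lein : (i - m <= n)%N by rewrite leq_subLR -ltnS.
    by rewrite -(subnKC lemi) glue_levelsR //= inordK.
  exists p => //; move: w; rewrite /preimage /= -pE config_weight_glue //.
  move=> /eqP; rewrite mulf_eq0 negb_or => /andP[/eqP w1 /eqP w2].
  case: C => [[N1 h0] [N2 v0] /= vb vt].
  by split; split=> //; split=> /=;
    [exists N1 => *; exact: h0 | exists N2 => *; exact: v0 | | |
     exists N1 => *; exact: h0 | exists N2 => *; exact: v0 | |];
    move=> c; rewrite ?i0 ?addn0 ?em ?vb ?iM ?vt.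
Qed.

Hypotheses (plam : is_part lam) (pmu : is_part mu).

Lemma skewF_branching :
  skewF q s lam mu x =
  \sum_(nu \in [set nu | [/\ is_part nu, part_incl nu lam & part_incl mu nu]])
    skewF q s nu mu x1 * skewF q s lam nu x2.
Proof.
set B := [set nu | _].
have finB : finite_set B.
  by apply: sub_finite_set (finite_parts_in lam) => nu [].
have finS := finite_support_configs _ q s _ _ _ x plam pmu.
(* Configurations are sorted by their level [m]: after exchanging the sums, exactly one [nu]
   contributes for each [hv], existing by [config_level_part] and unique by [mult_diff_inj]. *)
transitivity (\sum_(nu \in B) \sum_(hv \in support_configs q s lam mu x)
    if hv \in [set hv | hv.2 (inord m) = mult_diff nu]
    then config_weight q s x hv else 0).
  rewrite exchange_fsbig // skewF_support; apply: eq_fsbigr => hv /set_mem Shv.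
  have [nu [pnu nulam munu e]] :=
    config_level_part _ _ _ _ _ _ _ plam pmu _ _ Shv (leq_addr n m).
  have Bnu : B nu by [].
  rewrite (fsbigD1 nu) //= mem_set // fsbig1 ?addr0 // => nu' [[pnu' _ _] ne].
  rewrite memNset //= => e'; apply: ne; apply: mult_diff_inj => //.
  by move=> c; rewrite -e' e.
(* For fixed [nu], the bijection turns the fibre into a product set, over which the sum of products
   factors. *)
apply: eq_fsbigr => nu /set_mem[pnu _ _]; rewrite -fsbig_mkcondr.
rewrite (reindex_fsbig _ _ _ _ (glue_configs_bij nu)).
rewrite !skewF_support mulr_fsuml.
under [RHS]eq_fsbigr do rewrite mulr_fsumr.
rewrite pair_fsbig; [|exact: finite_support_configs..].
apply: eq_fsbigr => p /set_mem[[[_ _ _ e1] _] [[_ _ e2 _] _]].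
by rewrite config_weight_glue //; apply/funext => c; rewrite e1 e2.
Qed.

Hypothesis ctilde_neq0 : forall nu, ctilde_conj q s nu != 0.

(** The normalising ratios through [nu] telescope, which requires cancelling the nonzero constant of
    [nu]. *)
Lemma skewFdual_branching :
  skewFdual q s lam mu x =
  \sum_(nu \in [set nu | [/\ is_part nu, part_incl nu lam & part_incl mu nu]])
    skewFdual q s nu mu x1 * skewFdual q s lam nu x2.
Proof.
rewrite /skewFdual skewF_branching mulr_fsumr; apply: eq_fsbigr => nu _.
by rewrite [RHS]mulrACA; congr (_ * _); rewrite [RHS]mulrC mulrA divfK.
Qed.

End Glue.

(** * Nonvanishing of the normalising constants *)

Lemma qpoch_neq0 (K : numFieldType) (q a : K) (m : nat) :
  `|q| < 1 -> `|a| < 1 -> qpoch q a m != 0.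
Proof.
move=> hq ha; apply/prodf_neq0 => i _; rewrite subr_eq0.
(* A vanishing factor means [1 = a * q ^+ i], whence 1 = |a| |q|^i <= |a|, against |a| < 1. *)
apply: contraTneq ha => a1; rewrite -real_leNgt ?normr_real ?real1 //.
rewrite -[leLHS](@normr1 K) a1 normrM normrX ler_piMr // exprn_ile1 //.
exact: Order.POrderTheory.ltW.
Qed.

Lemma ctilde_conj_neq0 (K : numFieldType) (q s : K) (lam : seq nat) :
  `|q| < 1 -> `|s| < 1 -> ctilde_conj q s lam != 0.
Proof.
move=> hq hs; apply/prodf_neq0 => i _.
by rewrite mulf_neq0 ?invr_eq0 ?qpoch_neq0 // normrX exprn_ilt1.
Qed.

Theorem proposition6p1 (R : realType) (q s : R[i])
    (hq : `|q| < 1) (hs : `|s| < 1)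
    (m n : nat) (hm : (0 < m)%N) (hn : (0 < n)%N)
    (lam mu : seq nat) (hlam : is_part lam) (hmu : is_part mu)
    (hincl : part_incl mu lam) (x : 'I_(m + n) -> R[i]) :
  skewF q s lam mu x =
    \sum_(nu \in [set nu : seq nat |
                    [/\ is_part nu, part_incl nu lam & part_incl mu nu]])
      skewF q s nu mu (fun i : 'I_m => x (lshift n i)) *
      skewF q s lam nu (fun j : 'I_n => x (rshift m j))
  /\
  skewFdual q s lam mu x =
    \sum_(nu \in [set nu : seq nat |
                    [/\ is_part nu, part_incl nu lam & part_incl mu nu]])
      skewFdual q s nu mu (fun i : 'I_m => x (lshift n i)) *
      skewFdual q s lam nu (fun j : 'I_n => x (rshift m j)).
Proof.
split; first exact: skewF_branching.
by apply: skewFdual_branching => // nu; exact: ctilde_conj_neq0.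
Qed.
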